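(* Let $G=(V,E)$ be any finite connected graph and let $\alpha>1$. Then any star-forest $\mathbf G$ on $G$ admits a $(G,\alpha)$-stable allocation; that is, writing $\mathbf E$ for the set of edges of $\mathbf G$, there exists an equilibrium $\vec v$ of the WARM on $G$ with $W(x)=x^\alpha$ such that $v_e>0$ for all $e\in\mathbf E$, $v_e=0$ for all $e\in E\setminus\mathbf E$, and $\vec v$ is either linearly stable or critical.
   Context: A star-forest on $G$ is a collection $\mathbf G=\{G_j\}_{j=1}^k$ of connected subgraphs $G_j=(V_j,E_j)$ of $G$ with $|V_j|\ge2$, $V=\bigcup_jV_j$, $V_j\cap V_{j'}=\varnothing$ for $j\ne j'$, in which each $G_j$ is a star graph (a central vertex joined by one or more edges to leaves). $\mathbf E=\bigcup_jE_j$. WARM on $G$: the colours are the edges; at each time a vertex is chosen uniformly at random and one edge incident to it is selected with probability proportional to (its current count)$^\alpha$ and its count is increased by one. With $\Delta_{E}=\{\vec v\in\mathbb R^{E}:v_e\ge0,\ \sum_{e}v_e=1\}$, define for $\vec v\in\Delta_E$ $$F(\vec v)_e=-v_e+\frac1{|V|}\sum_{x\in e}\frac{v_e^\alpha}{\sum_{e'\in E:\,x\in e'}v_{e'}^\alpha},\qquad e\in E,$$ where $x\in e$ means that $x$ is an endvertex of $e$ (and $0/0$ is read as $0$; then $F(\vec v)=\vec 0$ forces every denominator to be positive). An equilibrium is a $\vec v\in\Delta_E$ with $F(\vec v)=\vec 0$. At an equilibrium, $\mathbf D(\vec v)$ is the matrix of partial derivatives $D_{e,e'}=\partial F(\vec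 v)_e/\partial v_{e'}$ (one-sided at points with zero coordinates). The equilibrium is linearly stable if all eigenvalues of $\mathbf D(\vec v)$ have negative real parts, linearly unstable if some eigenvalue has positive real part, and critical otherwise. *)

(* Defs.v *)
From HB Require Import structures.
From mathcomp Require Import all_boot all_order all_algebra.
From mathcomp Require Import all_classical all_reals all_analysis.
From mathcomp Require Import complex.

Set Implicit Arguments.
Unset Strict Implicit.
Unset Printing Implicit Defensive.
Import Order.TTheory GRing.Theory Num.Theory numFieldNormedType.Exports.
Local Open Scope ring_scope.

(** A finite simple graph is a finite vertex type [V] with a set [E] of
    two-element subsets of [V]. *)

Section Graphs.
Variable V : finType.
Implicit Types (E : {set {set V}}) (A : {set V}).

Definition simple_graph E : Prop := forall e, e \in E -> #|e| = 2%N.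

Definition adj E : rel V := fun x y => [set x; y]%SET \in E.

(** Connected graphs have at least one vertex; without this convention the
    empty graph would be connected, with an empty star-forest and an empty
    simplex. *)
Definition connected_graph E : Prop :=
  (0 < #|V|)%N /\ forall x y : V, connect (adj E) x y.

Record subgraph := Subgraph { sg_vert : {set V}; sg_edges : {set {set V}} }.
Implicit Type H : subgraph.

Definition is_subgraph E H : Prop :=
  sg_edges H \subset E /\ forall e, e \in sg_edges H -> e \subset sg_vert H.

Definition connected_subgraph H : Prop :=
  forall x y, x \in sg_vert H -> y \in sg_vert H ->
    connect (adj (sg_edges H)) x y.

Definition is_star H : Prop :=
  exists2 c, c \in sg_vert H &
    sg_edges H = [set [set c; y] | y in sg_vert H :\ c]%SET.

Definition star_forest E (k : nat) (G : 'I_k -> subgraph) : Prop :=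
  [/\ forall j, is_subgraph E (G j) /\ connected_subgraph (G j),
      forall j, (2 <= #|sg_vert (G j)|)%N,
      (\bigcup_(j < k) sg_vert (G j))%SET = [set: V]%SET,
      forall j j', j != j' -> [disjoint sg_vert (G j) & sg_vert (G j')] &
      forall j, is_star (G j)].

Definition forest_edges (k : nat) (G : 'I_k -> subgraph) : {set {set V}} :=
  (\bigcup_(j < k) sg_edges (G j))%SET.

End Graphs.

(** Vectors in [R^E] are row vectors of size [#|E|], and the coordinate [i] is
    the one of the edge [enum_val i]. *)

Section WARM.
Local Open Scope classical_set_scope.
Variables (R : realType) (V : finType) (E : {set {set V}}) (alpha : R).
Implicit Types (v : 'rV[R]_#|E|) (D : 'M[R]_#|E|).

Definition in_simplex v : Prop :=
  (forall i, 0 <= v 0 i) /\ \sum_i v 0 i = 1.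

(** [0 / 0 = 0] holds by the library's convention on inverses. *)
Definition warmF v : 'rV[R]_#|E| :=
  \row_i (- v 0 i + #|V|%:R^-1 *
    \sum_(x in (enum_val i : {set V}))
       v 0 i `^ alpha /
         \sum_(j < #|E| | x \in (enum_val j : {set V})) v 0 j `^ alpha).

Definition equilibrium v : Prop := in_simplex v /\ warmF v = 0.

(** The increment [h] is restricted by [0 <= v 0 j + h], which gives the
    two-sided derivative when [0 < v 0 j] and the right one when [v 0 j = 0]
    (the real power [`^] is not meaningful on negative numbers). *)
Definition is_jacobian v D : Prop :=
  forall i j,
    h^-1 * (warmF (v + h *: delta_mx 0 j) 0 i - warmF v 0 i)
      @[h --> within [set h : R | 0 <= v 0 j + h] 0^'] --> D i j.

Definition complex_eigenvalue D (z : R[i]) : Prop :=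
  eigenvalue (map_mx (real_complex R) D) z.

Definition linearly_stable v : Prop :=
  exists2 D, is_jacobian v D &
    forall z, complex_eigenvalue D z -> complex.Re z < 0.

Definition linearly_unstable v : Prop :=
  exists2 D, is_jacobian v D &
    exists2 z, complex_eigenvalue D z & 0 < complex.Re z.

(** The first conjunct excludes points where [F] has no Jacobian matrix. *)
Definition critical v : Prop :=
  [/\ exists D, is_jacobian v D, ~ linearly_stable v & ~ linearly_unstable v].

End WARM.

(* Main.v *)
Require Import Defs.
From HB Require Import structures.
From mathcomp Require Import all_boot all_order all_algebra.
From mathcomp Require Import all_classical all_reals all_analysis.
From mathcomp Require Import complex.
From mathcomp Require Import ring lra.
Import Order.TTheory GRing.Theory Num.Theory numFieldNormedType.Exports.
Local Open Scope ring_scope.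
Set Implicit Arguments.
Unset Strict Implicit.
Unset Printing Implicit Defensive.

(** A leaf reinforces its only edge with certainty, so with [n = #|V|] a star
    is at equilibrium iff [v_e = (1 + p_e) / n] where [p] is a probability on
    its edges and [p_e] is proportional to [(1 + p_e)^alpha].  Such a [p] is
    found with one edge of weight [q] and all the others of weight [r <= q],
    taking for [q] the largest zero of [r (1 + q)^alpha - q (1 + r)^alpha]:
    there the derivative is nonpositive, which amounts to
    [\sum_e w_e^2 (alpha / (1 + p_e) - 1 / p_e) <= 0] whenever
    [\sum_e w_e = 0].  As [alpha > 1], edges outside the forest only contribute
    the eigenvalue [-1] to the Jacobian matrix, and on a star a left
    eigenvector [y] for [z] satisfies [(1 + z) y = alpha w / (1 + p)] with
    [w = p (y - \sum p y)].  Pairing with [w] gives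
    [(1 + z) \sum |w|^2 / p = alpha \sum |w|^2 / (1 + p) <= \sum |w|^2 / p],
    so that [Re z <= 0]. *)

(** * Last zero of a continuous function and the sign of its derivative there *)

Section LastZero.
Local Open Scope classical_set_scope.

(** The zero is the supremum [s] of the points of [[a, b]] where [f] is nonnegative: by continuity,
    [f s < 0] would leave no such points near [s], and [f s > 0] would produce some beyond [s]. *)
Lemma exists_last_zero (R : realType) (f : R -> R) (a b : R) :
  a <= b -> (forall x, x \in `[a, b]%R -> {for x, continuous f}) ->
  0 <= f a -> f b < 0 ->
  exists x, [/\ a <= x, x < b, f x = 0 & forall y, x < y -> y <= b -> f y < 0].
Proof.
move=> ab cf fa fb.
pose A := [set x | x \in `[a, b]%R /\ 0 <= f x].
have Aa : A a by split=> //; rewrite in_itv/= lexx.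
have hsA : has_sup A.
  split; first by exists a.
  by exists b => x [+ _]; rewrite in_itv/= => /andP[].
pose s := sup A.
have as_ : a <= s by exact: sup_upper_bound.
have sb : s <= b.
  by apply: ge_sup; [exists a | move=> x [+ _]; rewrite in_itv/= => /andP[]].
have sab : s \in `[a, b]%R by rewrite in_itv/= as_.
have cs := cf _ sab.
have fs_ge0 : 0 <= f s.
  rewrite leNgt; apply/negP => fs_lt0.
  have /nbhs_ballP[e /= e0 he] : \forall x \near s, f x < 0.
    exact: cvgr_lt cs _ fs_lt0.
  have [x Ax sx] := sup_adherent e0 hsA.
  have xs : x <= s by exact: sup_upper_bound.
  have : f x < 0.
    by apply: he; rewrite /ball/= ger0_norm ?subr_ge0//; rewrite -/s in sx; lra.
  by case: Ax => _; rewrite leNgt => /negbTE ->.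
have s_lt_b : s < b.
  rewrite lt_neqAle sb andbT; apply/eqP => sE.
  by move: fs_ge0; rewrite sE leNgt fb.
have after y : s < y -> y <= b -> f y < 0.
  move=> sy yb; rewrite ltNge; apply/negP => fy.
  suff : y <= s by rewrite leNgt sy.
  apply: sup_upper_bound => //; split => //.
  by rewrite in_itv/= yb (le_trans as_ (ltW sy)).
exists s; split => //; apply/eqP; rewrite eq_le fs_ge0 andbT leNgt.
apply/negP => fs_gt0.
have /nbhs_ballP[e /= e0 he] : \forall x \near s, 0 < f x.
  exact: cvgr_gt cs _ fs_gt0.
pose d := Num.min (e / 2) (b - s).
have d0 : 0 < d by rewrite lt_min divr_gt0//= subr_gt0.
have : f (s + d) < 0.
  apply: after; first by rewrite ltrDl.
  by rewrite -lerBrDl ge_min lexx orbT.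
apply/negP; rewrite -leNgt ltW//; apply: he.
rewrite /ball/= opprD addrA subrr add0r normrN gtr0_norm//.
by rewrite gt_min; apply/orP; left; rewrite gtr_pMr// invf_lt1// ltr1n.
Qed.

Lemma derive_le0_of_neg_right (R : realType) (f : R -> R) (x b l : R) :
  is_derive x 1 f l -> x < b -> f x = 0 ->
  (forall y, x < y -> y <= b -> f y < 0) -> l <= 0.
Proof.
move=> [df <-] xb fx neg.
have /cvg_ex[/= l' hl'] := df.
have -> : 'D_1 f x = l' by exact: cvg_lim hl'.
have {}hl' : h^-1 *: (f (h *: 1 + x) - f x) @[h --> 0^'+] --> l'.
  exact: cvg_dnbhs_at_right hl'.
apply: (cvgr_to_le hl').
near=> h.
have h0 : 0 < h by [].
rewrite fx subr0 /GRing.scale/= pmulr_rle0 ?invr_gt0// mulr1 addrC ltW// neg//.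
  by rewrite ltrDl.
rewrite -lerBrDl; near: h; apply: nbhs_right_le.
by rewrite subr_gt0.
Unshelve. all: by end_near. Qed.

End LastZero.

(** * Equilibrium weights on a single star *)

(* [c] is the number of edges of weight [r]. *)
Lemma exists_two_level_weights (R : realType) (alpha c : R) : 0 < c ->
  exists q r, [/\ 0 < r, r <= q, q + c * r = 1,
    r * (1 + q) `^ alpha = q * (1 + r) `^ alpha &
    (alpha / (1 + q) - q^-1) + (alpha / (1 + r) - r^-1) / c <= 0].
Proof.
move=> c0.
(* Normalisation determines [r] from [q]; the zeros of [G] are then the solutions of the
   proportionality equation. *)
pose r (q : R) : R := (1 - q) / c.
pose G (q : R) : R := r q * (1 + q) `^ alpha - q * (1 + r q) `^ alpha.
pose dpow (x : R) := alpha * x `^ (alpha - 1).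
pose dG (q : R) : R := - c^-1 * (1 + q) `^ alpha + r q * dpow (1 + q)
   - ((1 + r q) `^ alpha + q * (dpow (1 + r q) * (- c^-1))).
have dGP (q : R) : 0 < q <= 1 -> is_derive q (1 : R) G (dG q).
  move=> /andP[q0 q1].
  have rq0 : 0 <= r q by rewrite divr_ge0 ?subr_ge0// ltW.
  have dr : is_derive q (1 : R) r (- c^-1).
    rewrite /r; apply: is_derive_eq; rewrite /GRing.scale/=; ring.
  have d1 : is_derive q (1 : R) (fun q : R => 1 + q) 1.
    by apply: is_derive_eq; ring.
  have d1r : is_derive q (1 : R) (fun q : R => 1 + r q) (- c^-1).
    by apply: is_derive_eq; ring.
  have p1 : 0 < 1 + q by rewrite ltr_wpDr ?ltW.
  have p2 : 0 < 1 + r q by rewrite ltr_wpDr.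
  have dp1 : is_derive q (1 : R) (fun q : R => (1 + q) `^ alpha)
      (dpow (1 + q)).
    have := @is_derive1_comp _ (@powR R ^~ alpha) (fun q : R => 1 + q) q _ _
      (is_derive1_powR alpha p1) d1.
    by rewrite mulr1.
  have dp2 : is_derive q (1 : R) (fun q : R => (1 + r q) `^ alpha)
      (dpow (1 + r q) * (- c^-1)).
    exact: (@is_derive1_comp _ (@powR R ^~ alpha) (fun q : R => 1 + r q) q _ _
      (is_derive1_powR alpha p2) d1r).
  rewrite /G; apply: is_derive_eq; rewrite /dG /GRing.scale/=; ring.
(* The search starts at equal weights on all [1 + c] edges, where [G] vanishes, and ends at [q = 1],
   where [G] is [-1]. *)
pose a : R := (1 + c)^-1.
have a0 : 0 < a by rewrite invr_gt0 addr_gt0.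
have a1 : a <= 1 by rewrite invf_le1 ?lerDl ?ltW// addr_gt0.
have ra : r a = a by rewrite /r /a; field; rewrite !gt_eqF// addr_gt0.
have r1 : r 1 = 0 by rewrite /r subrr mul0r.
have [|||q [aq q1 Gq neg]] := @exists_last_zero R G a 1 a1.
- move=> x; rewrite in_itv/= => /andP[ax x1].
  have [|+ _] := dGP x; first by rewrite x1 (lt_le_trans a0 ax).
  by move=> /derivable1_diffP/differentiable_continuous.
- by rewrite /G ra subrr.
- by rewrite /G r1 mul0r addr0 powR1 mulr1 sub0r ltrN10.
have q0 := lt_le_trans a0 aq.
have rq0 : 0 < r q by rewrite divr_gt0 ?subr_gt0.
exists q, (r q); split => //.
- rewrite /r ler_pdivrMr// lerBlDr -[X in _ <= _ + X]mulr1 -mulrDr addrC.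
  by rewrite -ler_pdivrMr ?addr_gt0// div1r.
- by rewrite /r; field; rewrite gt_eqF.
- by apply/eqP; rewrite -subr_eq0 -/(G q) Gq.
have p1 : 0 < 1 + q by rewrite addr_gt0.
have p2 : 0 < 1 + r q by rewrite addr_gt0.
have dG0 : dG q <= 0.
  apply: (@derive_le0_of_neg_right R G q 1 (dG q)) => //.
  by apply: dGP; rewrite q0 ltW.
(* At a zero of [G] the ratio [M] is the same for [q] and [r q]. Factoring it out turns the
   derivative of [G] into a positive multiple of the quantity to be bounded. *)
pose M := (1 + q) `^ alpha / q.
have Eq : (1 + q) `^ alpha = M * q by rewrite /M divfK// gt_eqF.
have Er : (1 + r q) `^ alpha = M * r q.
  move/eqP : Gq; rewrite /G subr_eq0 Eq => /eqP h.
  by apply: (@mulfI _ q); [rewrite gt_eqF | rewrite -h; ring].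
have M0 : 0 < M by rewrite divr_gt0 ?powR_gt0.
suff dGE : dG q = M * q * r q *
    ((alpha / (1 + q) - q^-1) + (alpha / (1 + r q) - (r q)^-1) / c).
  have pM : 0 < M * q * r q by apply: mulr_gt0 => //; apply: mulr_gt0.
  by move: dG0; rewrite dGE (pmulr_rle0 _ pM).
have powB x : 0 < x -> x `^ (alpha - 1) = x `^ alpha / x.
  by move=> x0; rewrite powRB ?powRr1 ?(ltW x0)// (gt_eqF x0) implybT.
rewrite /dG /dpow !powB// Eq Er.
field; rewrite !gt_eqF//.
Qed.

Lemma exists_star_weights (R : realType) (alpha : R) (I : finType)
    (T : {set I}) : (0 < #|T|)%N ->
  exists p : I -> R,
    [/\ forall i, 0 < p i, \sum_(i in T) p i = 1,
        forall i, i \in T ->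
          (1 + p i) `^ alpha = p i * \sum_(j in T) (1 + p j) `^ alpha &
        forall w : I -> R, \sum_(i in T) w i = 0 ->
          \sum_(i in T) w i ^+ 2 * (alpha / (1 + p i) - (p i)^-1) <= 0].
Proof.
case/card_gt0P => i0 i0T.
have big_T (F : I -> R) :
    \sum_(i in T) F i = F i0 + \sum_(i in T | i != i0) F i.
  by rewrite (bigD1 i0).
pose c : R := (\sum_(i in T | i != i0) 1)%:R.
have cE (x : R) : \sum_(i in T | i != i0) x = c * x.
  by rewrite big_const -Monoid.iteropE /c sum1_card mulr_natl; elim: #|_|.
have c_ge0 : 0 <= c by [].
(* A star with a single edge: its weight is 1, and a [w] of zero sum vanishes there. *)
have [c0|c_neq0] := eqVneq c 0.
  have no_other i : (i \in T) && (i != i0) = false.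
    apply/negP => iT; move: c0 => /eqP; rewrite /c pnatr_eq0.
    by rewrite (bigD1 i).
  exists (fun=> 1); split => // [|i iT|w]; rewrite !big_T.
  - by rewrite big_pred0// addr0.
  - by rewrite big_pred0// addr0 mul1r.
  - by rewrite big_pred0// addr0 => ->; rewrite big_pred0// addr0 expr0n mul0r.
have c_gt0 : 0 < c by rewrite lt_def c_neq0.
have [q [r [r0 rq qr1 eq_qr kappa_le0]]] :=
  exists_two_level_weights alpha c_gt0.
have q0 := lt_le_trans r0 rq.
pose p i := if i == i0 then q else r.
have sum_others (F : R -> R) :
    \sum_(i in T | i != i0) F (p i) = c * F r.
  by rewrite -cE; apply: eq_bigr => i /andP[_ /negPf h]; rewrite /p h.
have pi0 : p i0 = q by rewrite /p eqxx.
exists p; split => [i||i iT|w].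
- by rewrite /p; case: ifP.
- by rewrite big_T pi0 (sum_others id).
- rewrite big_T pi0 (sum_others (fun x => (1 + x) `^ alpha)).
  rewrite /p; case: ifP => _.
    by rewrite mulrDr mulrCA -eq_qr mulrA -mulrDl qr1 mul1r.
  by rewrite mulrDr eq_qr mulrA -mulrDl mulrC [r * c]mulrC qr1 mulr1.
rewrite !big_T pi0 => w_sum.
pose kq := alpha / (1 + q) - q^-1; pose kr := alpha / (1 + r) - r^-1.
pose W := \sum_(i in T | i != i0) w i ^+ 2.
have -> : \sum_(i in T | i != i0) w i ^+ 2 * (alpha / (1 + p i) - (p i)^-1)
    = W * kr.
  by rewrite mulr_suml; apply: eq_bigr => i /andP[_ /negPf h]; rewrite /p h.
rewrite -/kq -/kr in kappa_le0 *.
have k_gt0 (x : R) : 0 < x ->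
    (0 < alpha / (1 + x) - x^-1) = (1 < (alpha - 1) * x).
  move=> x0; have x1 : 0 < 1 + x by rewrite addr_gt0.
  have -> : alpha / (1 + x) - x^-1 = ((alpha - 1) * x - 1) / (x * (1 + x)).
    by field; rewrite !gt_eqF.
  by rewrite pmulr_lgt0 ?subr_gt0// invr_gt0 mulr_gt0.
(* If [kr] were positive, then [alpha > 1], and [r <= q] would make [kq] positive too, against the
   bound on [kq + kr / c]. *)
have kr_le0 : kr <= 0.
  rewrite leNgt; apply/negP => kr0.
  suff kq0 : 0 < kq by have := divr_gt0 kr0 c_gt0; lra.
  by move: kr0; rewrite /kr /kq !k_gt0// => h; nra.
(* Cauchy-Schwarz, by expanding the squared deviations of the other [w i] from their mean
   [- w i0 / c]. *)
have W_ge : w i0 ^+ 2 / c <= W.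
  have : 0 <= \sum_(i in T | i != i0) (w i + w i0 / c) ^+ 2.
    by apply: sumr_ge0 => i _; exact: sqr_ge0.
  under eq_bigr do rewrite sqrrD.
  rewrite !big_split/= cE -/W -mulr_suml.
  have -> : \sum_(i in T | i != i0) w i = - w i0 by lra.
  have -> : W + (- w i0 * (w i0 / c) + - w i0 * (w i0 / c))
      + c * (w i0 / c) ^+ 2
      = W - w i0 ^+ 2 / c by field.
  by rewrite subr_ge0.
(* As [kr <= 0], replacing [W] by its lower bound can only increase the form. *)
apply: le_trans (_ : w i0 ^+ 2 * kq + w i0 ^+ 2 / c * kr <= 0).
  by rewrite lerD2l ler_wnM2r.
by rewrite -mulrA -mulrDr [c^-1 * _]mulrC mulr_ge0_le0// sqr_ge0.
Qed.

(** * Eigenvalues on the block of a star, in real and imaginary parts *)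

Lemma rotation_eq0 (R : realFieldType) (a b s t : R) : 0 < s ->
  - a = s * a - t * b -> - b = s * b + t * a -> a = 0 /\ b = 0.
Proof.
move=> s0 ea eb.
(* With [y = a + i b] and [z = s + i t] the hypotheses say [(1 + z) y = 0]; this is the squared
   modulus of that equation. *)
have : ((1 + s) ^+ 2 + t ^+ 2) * (a ^+ 2 + b ^+ 2) = 0.
  have e1 : (1 + s) * a - t * b = 0 by lra.
  have e2 : (1 + s) * b + t * a = 0 by lra.
  transitivity (((1 + s) * a - t * b) ^+ 2 + ((1 + s) * b + t * a) ^+ 2).
    ring.
  by rewrite e1 e2 expr0n addr0.
move=> /eqP; rewrite mulf_eq0 gt_eqF /=; last first.
  by rewrite ltr_wpDr ?sqr_ge0// exprn_gt0// addr_gt0.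
by rewrite paddr_eq0 ?sqr_ge0// !sqrf_eq0 => /andP[/eqP -> /eqP ->].
Qed.

Section StarSpectrum.
Variables (R : realFieldType) (I : finType) (T : {set I}).
Variables (alpha : R) (p : I -> R).
Hypothesis p_gt0 : forall i, 0 < p i.
Hypothesis p_sum : \sum_(i in T) p i = 1.
Hypothesis p_form : forall w : I -> R, \sum_(i in T) w i = 0 ->
  \sum_(i in T) w i ^+ 2 * (alpha / (1 + p i) - (p i)^-1) <= 0.

(* [a + i b] is a left eigenvector for the eigenvalue [s + i t], on the block
   of a star in the Jacobian matrix. *)
Lemma star_spectrum (a b : I -> R) (s t : R) :
  let w (y : I -> R) i := p i * (y i - \sum_(j in T) p j * y j) in
  (forall i, i \in T ->
     - a i + alpha / (1 + p i) * w a i = s * a i - t * b i) ->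
  (forall i, i \in T ->
     - b i + alpha / (1 + p i) * w b i = s * b i + t * a i) ->
  0 < s -> forall i, i \in T -> a i = 0 /\ b i = 0.
Proof.
move=> w ha hb s0.
have w_sum y : \sum_(i in T) w y i = 0.
  rewrite /w; under eq_bigr do rewrite mulrBr.
  by rewrite sumrB -mulr_suml p_sum mul1r subrr.
pose Q y := \sum_(i in T) w y i ^+ 2 / p i.
pose U y := \sum_(i in T) w y i ^+ 2 * (alpha / (1 + p i)).
have UQ y : U y <= Q y.
  rewrite -subr_le0 -sumrB; under eq_bigr do rewrite -mulrBr.
  exact: p_form.
(* Subtracting the mean of [y] changes nothing, since [w y'] has zero sum; the right side is
   symmetric in [y] and [y']. *)
have pair y y' : \sum_(i in T) y i * w y' i
    = \sum_(i in T) w y i * w y' i / p i.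
  apply/eqP; rewrite -subr_eq0 -sumrB.
  rewrite (eq_bigr (fun i => (\sum_(j in T) p j * y j) * w y' i)).
    by rewrite -mulr_sumr w_sum mulr0.
  by move=> i _; rewrite {2}/w; field; rewrite gt_eqF.
have QE y : Q y = \sum_(i in T) y i * w y i by rewrite pair.
(* Real part of the pairing of the eigenvector equation with the conjugate of [w]; the terms in [t]
   cancel by the symmetry of [pair]. *)
have key : (1 + s) * (Q a + Q b) = U a + U b.
  have skew : \sum_(i in T) a i * w b i = \sum_(i in T) b i * w a i.
    by rewrite !pair; apply: eq_bigr => i _; rewrite [w a i * _]mulrC.
  transitivity ((1 + s) * (Q a + Q b)
      + t * (\sum_(i in T) a i * w b i - \sum_(i in T) b i * w a i)).
    by rewrite skew subrr mulr0 addr0.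
  rewrite !QE -big_split -sumrB !mulr_sumr -!big_split.
  apply: eq_bigr => i iT /=.
  have ea : alpha / (1 + p i) * w a i = (1 + s) * a i - t * b i.
    by rewrite mulrDl mul1r -addrA -ha//; ring.
  have eb : alpha / (1 + p i) * w b i = (1 + s) * b i + t * a i.
    by rewrite mulrDl mul1r -addrA -hb//; ring.
  have sq y : w y i ^+ 2 * (alpha / (1 + p i))
      = alpha / (1 + p i) * w y i * w y i.
    by ring.
  by rewrite !sq ea eb; ring.
have Q_ge0 y : 0 <= Q y.
  by apply: sumr_ge0 => i _; rewrite divr_ge0 ?sqr_ge0// ltW.
have Q0 y : Q y = 0 -> forall i, i \in T -> w y i = 0.
  move=> /eqP; rewrite psumr_eq0; last first.
    by move=> i _; rewrite divr_ge0 ?sqr_ge0// ltW.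
  move=> /allP h i iT; have := h i (mem_index_enum _); rewrite iT /=.
  by rewrite mulf_eq0 invr_eq0 (gt_eqF (p_gt0 i)) orbF sqrf_eq0 => /eqP.
(* [(1 + s) Q = U <= Q] for the sums over [a] and [b], while [s > 0]. *)
have Qab : Q a + Q b <= 0.
  have := UQ a; have := UQ b; have := Q_ge0 a; have := Q_ge0 b.
  by move: key; rewrite mulrDl mul1r => key *; nra.
have Qa0 : Q a = 0.
  by apply/eqP; rewrite eq_le Q_ge0 andbT; have := Q_ge0 b; lra.
have Qb0 : Q b = 0.
  by apply/eqP; rewrite eq_le Q_ge0 andbT; have := Q_ge0 a; lra.
(* Once [w] vanishes, the eigenvector equation reduces to [- y = z y]. *)
move=> i iT.
have := ha i iT; have := hb i iT.
rewrite (Q0 _ Qa0)// (Q0 _ Qb0)// !mulr0 !addr0 => eb ea.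
exact: (rotation_eq0 s0 ea eb).
Qed.

End StarSpectrum.

(** * Calculus of derivatives at 0 along a filter *)

Section Slope.
Local Open Scope classical_set_scope.
Context {R : realType}.
Variable F : set_system R.
Context {FF : Filter F}.
Hypothesis F0 : F --> (0 : R)^'.
Implicit Types f g : R -> R.

(** Leaving [F] abstract treats the two-sided and the right derivatives of [is_jacobian] at once. *)
Definition slope f (l : R) := h^-1 * (f h - f 0) @[h --> F] --> l.

Lemma slope_neq0 : \forall h \near F, h != 0.
Proof. exact: (F0 (nbhs_dnbhs_neq (0 : R))). Qed.

Lemma slope_cvg0 f l : slope f l -> f h @[h --> F] --> f 0.
Proof.
move=> fl.
have id0 : h @[h --> F] --> (0 : R).
  by apply: (cvg_trans F0); exact: nbhs_dnbhs.
have : f 0 + h * (h^-1 * (f h - f 0)) @[h --> F] --> f 0 + 0 * l.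
  by apply: cvgD; [exact: cvg_cst | exact: cvgM].
rewrite mul0r addr0; apply: cvg_trans; apply: near_eq_cvg.
near=> h; have h0 : h != 0 by near: h; exact: slope_neq0.
by rewrite mulrA divff// mul1r addrC subrK.
Unshelve. all: by end_near. Qed.

Lemma slope_cst c : slope (fun=> c) 0.
Proof.
rewrite /slope (_ : (fun _ => _) = fun=> 0); first exact: cvg_cst.
by apply/funext => h; rewrite subrr mulr0.
Qed.

Lemma slopeD f g k l : slope f k -> slope g l ->
  slope (fun h => f h + g h) (k + l).
Proof.
move=> fk gl; rewrite /slope (_ : (fun _ => _) =
  fun h => h^-1 * (f h - f 0) + h^-1 * (g h - g 0)); first exact: cvgD.
by apply/funext => h; ring.
Qed.

Lemma slopeM f g k l : slope f k -> slope g l ->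
  slope (fun h => f h * g h) (k * g 0 + f 0 * l).
Proof.
move=> fk gl; rewrite /slope (_ : (fun _ => _) =
  fun h => h^-1 * (f h - f 0) * g h + f 0 * (h^-1 * (g h - g 0))).
  apply: cvgD; first by apply: cvgM => //; exact: (slope_cvg0 gl).
  by apply: cvgM => //; exact: cvg_cst.
by apply/funext => h; ring.
Qed.

Lemma slopeV f l : f 0 != 0 -> slope f l ->
  slope (fun h => (f h)^-1) (- l / f 0 ^+ 2).
Proof.
move=> f0 fl; have fc := slope_cvg0 fl.
have : - (h^-1 * (f h - f 0)) * (f h * f 0)^-1 @[h --> F] --> - l / f 0 ^+ 2.
  apply: cvgM; first exact: cvgN.
  rewrite expr2; apply: cvgV; first by rewrite mulf_neq0.
  by apply: cvgM => //; exact: cvg_cst.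
apply: cvg_trans; apply: near_eq_cvg; near=> h.
have h0 : h != 0 by near: h; exact: slope_neq0.
have fh0 : f h != 0 by near: h; exact: cvgr_neq0 fc f0.
by field; rewrite h0 f0 fh0.
Unshelve. all: by end_near. Qed.

Lemma slope_sum (I : Type) (r : seq I) (P : pred I) (f : I -> R -> R)
    (l : I -> R) :
  (forall i, P i -> slope (f i) (l i)) ->
  slope (fun h => \sum_(i <- r | P i) f i h) (\sum_(i <- r | P i) l i).
Proof.
move=> fl; rewrite /slope; elim: r => [|i r IH].
  by under eq_fun do rewrite !big_nil; rewrite big_nil; exact: slope_cst.
under eq_fun do rewrite !big_cons; rewrite big_cons.
by case: ifP => Pi //; exact: (slopeD (fl _ Pi) IH).
Qed.

End Slope.

Section PowerSlope.
Local Open Scope classical_set_scope.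

(** At [a = 0] only [h > 0] is allowed and the quotient is [h^(alpha - 1)], which tends to 0 as
    [alpha > 1]. For [a > 0] the usual derivative is restricted to a finer filter. *)
Lemma slope_powR (R : realType) (alpha a : R) : 1 < alpha -> 0 <= a ->
  slope (within [set h : R | 0 <= a + h] 0^')
        (fun h => (a + h) `^ alpha) (alpha * a `^ (alpha - 1)).
Proof.
move=> alpha1; rewrite le_eqVlt => /orP[/eqP<-|a0].
  rewrite powR0 ?subr_eq0 ?gt_eqF// mulr0.
  have : h `^ (alpha - 1) @[h --> (0 : R)^'+] --> (0 : R).
    by apply: powR_cvg0; rewrite subr_gt0.
  move=> lim0.
  have sub : within [set h : R | 0 <= 0 + h] (0 : R)^' --> (0 : R)^'+.
    move=> A; rewrite /at_right /dnbhs /within /nbhs /=.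
    apply: filterS => h hA h0 /= hge; apply: hA.
    by rewrite lt_def h0 -(add0r h).
  have {lim0} := cvg_trans (cvg_app _ sub) lim0.
  apply: cvg_trans; apply: near_eq_cvg.
  have : \forall h \near (0 : R)^'+,
      h^-1 * ((0 + h) `^ alpha - (0 + 0) `^ alpha) = h `^ (alpha - 1).
    near=> h; have h0 : 0 < h by [].
    have alpha0 : alpha != 0 by rewrite gt_eqF// (lt_trans ltr01).
    rewrite !add0r (powR0 alpha0) subr0 powRB ?powRr1 ?(ltW h0)//; last first.
      by rewrite (gt_eqF h0) implybT.
    by rewrite mulrC.
  by move=> /sub; apply: filterS => h ->.
have [df val] := is_derive1_powR alpha a0.
have /cvg_ex[/= l hl] := df.
have lE : 'D_1 ((@powR R)^~ alpha) a = l by exact: cvg_lim hl.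
rewrite -val lE /slope addr0.
apply: (cvg_trans _ hl); apply: (cvg_trans (cvg_app _ (@cvg_within _ _ _ _))).
apply: near_eq_cvg; near=> h.
by rewrite /GRing.scale/= mulr1 [h + a]addrC.
Unshelve. all: by end_near. Qed.

End PowerSlope.

(** * The Jacobian matrix of the WARM vector field *)

Section Jacobian.
Local Open Scope classical_set_scope.
Variables (R : realType) (V : finType) (E : {set {set V}}) (alpha : R).
Hypothesis alpha1 : 1 < alpha.
Implicit Types (v : 'rV[R]_#|E|) (D : 'M[R]_#|E|).

Definition vertex_weight v (x : V) : R :=
  \sum_(j < #|E| | x \in (enum_val j : {set V})) v 0 j `^ alpha.

(** The quotient rule at each endvertex [x]: the numerator depends on coordinate [j] only if
    [i = j], the denominator only if [x] lies on edge [j]. *)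
Definition warm_jacobian v : 'M[R]_#|E| :=
  \matrix_(i, j) (- (i == j)%:R + #|V|%:R^-1 *
    \sum_(x in (enum_val i : {set V}))
      ((i == j)%:R * (alpha * v 0 j `^ (alpha - 1)) / vertex_weight v x
       - v 0 i `^ alpha
         * ((x \in (enum_val j : {set V}))%:R * (alpha * v 0 j `^ (alpha - 1)))
         / vertex_weight v x ^+ 2)).

Lemma warm_jacobianP v : (forall i, 0 <= v 0 i) ->
  (forall x, vertex_weight v x != 0) -> is_jacobian alpha v (warm_jacobian v).
Proof.
move=> v_ge0 w_neq0 i j.
set F := within _ _; have FF : Filter F by exact: within_filter.
have F0 : F --> (0 : R)^' by exact: cvg_within.
pose vh (h : R) := v + h *: delta_mx 0 j.
have vhE h k : vh h 0 k = v 0 k + (if k == j then h else 0).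
  by rewrite !mxE /=; case: ifP => _; rewrite ?mulr1 ?mulr0.
have vh0 : vh 0 = v by rewrite /vh scale0r addr0.
pose b := alpha * v 0 j `^ (alpha - 1).
have pow_slope k : slope F (fun h => vh h 0 k `^ alpha) ((k == j)%:R * b).
  have [->|kj] := eqVneq k j.
    rewrite mul1r (_ : (fun _ => _) = fun h => (v 0 j + h) `^ alpha).
      exact: slope_powR.
    by apply/funext => h; rewrite vhE eqxx.
  rewrite mul0r (_ : (fun _ => _) = fun=> v 0 k `^ alpha).
    exact: slope_cst.
  by apply/funext => h; rewrite vhE (negPf kj) addr0.
have lin_slope : slope F (fun h => - vh h 0 i) (- (i == j)%:R).
  have : (fun=> - (i == j)%:R : R) @ F --> (- (i == j)%:R : R).
    exact: cvg_cst.
  apply: cvg_trans; apply: near_eq_cvg; near=> h.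
  have h0 : h != 0 by near: h; exact: slope_neq0.
  rewrite vh0 vhE; case: ifP => _.
    by rewrite mulr1n; field.
  by rewrite addr0 subrr mulr0 oppr0.
have weight_slope x : slope F (fun h => vertex_weight (vh h) x)
    ((x \in (enum_val j : {set V}))%:R * b).
  (* The indicator becomes a sum over the edges at [x], the form in which [slope_sum] delivers the
     derivative. *)
  have -> : (x \in (enum_val j : {set V}))%:R
      = \sum_(k < #|E| | x \in (enum_val k : {set V})) (k == j)%:R :> R.
    rewrite big_mkcond (bigD1 j)//= eqxx big1 ?addr0 => [|k /negPf ->].
      by case: ifP.
    by case: ifP.
  by rewrite mulr_suml; apply: slope_sum => k _; exact: pow_slope.
have term_slope x : slope F
    (fun h => vh h 0 i `^ alpha / vertex_weight (vh h) x)
    ((i == j)%:R * b / vertex_weight v x - v 0 i `^ alpha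
         * ((x \in (enum_val j : {set V}))%:R * b) / vertex_weight v x ^+ 2).
  have w0 : vertex_weight (vh 0) x != 0 by rewrite vh0.
  have := slopeM F0 (pow_slope i) (slopeV F0 w0 (weight_slope x)).
  by move=> /(_ FF FF); rewrite /= vh0 mulNr mulrN mulrA.
have sum_slope := slope_sum (FF := FF) (r := index_enum V)
  (P := fun x => x \in (enum_val i : {set V})) (fun x _ => term_slope x).
have := slopeD lin_slope (slopeM F0 (slope_cst (F := F) #|V|%:R^-1) sum_slope).
move=> /(_ FF FF FF); rewrite mul0r add0r /slope vh0 [warm_jacobian v i j]mxE.
apply: cvg_trans; apply: near_eq_cvg; near=> h.
by rewrite !mxE -/(vh h).
Unshelve. all: by end_near. Qed.

(** As [v] is nonnegative, small [h > 0] are always admissible, so every entry is a limit from the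
    right. *)
Lemma jacobian_unique v D D' : (forall i, 0 <= v 0 i) ->
  is_jacobian alpha v D -> is_jacobian alpha v D' -> D = D'.
Proof.
move=> v_ge0 JD JD'; apply/matrixP => i j.
have sub : (0 : R)^'+ --> within [set h : R | 0 <= v 0 j + h] (0 : R)^'.
  move=> A hA.
  have {}hA : \forall h \near (0 : R), h != 0 -> 0 <= v 0 j + h -> A h.
    exact: hA.
  suff : \forall h \near (0 : R), 0 < h -> A h by [].
  apply: filterS hA => h hA h0; apply: hA; first by rewrite gt_eqF.
  by rewrite addr_ge0// ltW.
have DE := cvg_trans (cvg_app _ sub) (JD i j).
have D'E := cvg_trans (cvg_app _ sub) (JD' i j).
exact: (cvg_unique _ DE D'E).
Qed.

End Jacobian.

(** Acting from the left puts the factor [v_j^(alpha - 1)] in front of every term but [- a j], so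
    only [- a j] survives on an edge of weight 0. The bracket is [a j] minus the mean of [a] under
    the selection probabilities at [x]. *)
Lemma warm_jacobian_left (R : realType) (V : finType) (E : {set {set V}})
    (alpha : R) (v : 'rV[R]_#|E|) (a : 'I_#|E| -> R) (j : 'I_#|E|) :
  \sum_i a i * warm_jacobian alpha v i j = - a j + #|V|%:R^-1 *
    \sum_(x in (enum_val j : {set V}))
      alpha * v 0 j `^ (alpha - 1) / vertex_weight alpha v x
      * (a j - (\sum_(i < #|E| | x \in (enum_val i : {set V}))
                  v 0 i `^ alpha * a i) / vertex_weight alpha v x).
Proof.
set b := alpha * _; pose S := vertex_weight alpha v.
under eq_bigr => i _ do rewrite mxE -/b mulrDr mulrCA mulrN -mulNr.
rewrite big_split /= -mulr_sumr; congr (_ + _ * _).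
  rewrite (bigD1 j)//= eqxx mulr1 big1 ?addr0// => i /negPf ->.
  by rewrite mulr0.
(* Both inner sums are extended to all vertices: the first double sum then collapses to [i = j], and
   the second can be exchanged. *)
transitivity (\sum_(i < #|E|) \sum_x
    (if x \in (enum_val i : {set V}) then (i == j)%:R * (a i * b / S x) else 0)
  - \sum_(i < #|E|) \sum_x (if x \in (enum_val i : {set V}) then
     a i * v 0 i `^ alpha * ((x \in (enum_val j : {set V}))%:R * b) / S x ^+ 2
     else 0)).
  rewrite -sumrB; apply: eq_bigr => i _.
  rewrite mulr_sumr -sumrB big_mkcond; apply: eq_bigr => x _.
  by case: ifP => _; rewrite ?subrr// /S; ring.
rewrite [X in X - _](bigD1 j)//= [X in _ + X - _]big1 ?addr0; last first.
  by move=> i /negPf ij; apply: big1 => x _; rewrite ij mul0r if_same.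
rewrite exchange_big -sumrB [RHS]big_mkcond; apply: eq_bigr => x _ /=.
rewrite -big_mkcond eqxx mul1r; case: ifP => xj; last first.
  by rewrite big1 ?subrr// => i _; rewrite mul0r mulr0 mul0r.
rewrite mulrBr; congr (_ - _); first by rewrite -mulrA [RHS]mulrC.
rewrite mulr_suml mulr_sumr; apply: eq_bigr => i _.
by rewrite mul1r -exprVn /S; ring.
Qed.

(** * Combinatorics of star-forests *)

(* [c j] is the centre of the [j]-th star and [T j] the set of indices of its
   edges; the vertex [y] below is the leaf of the edge [i]. *)
Lemma star_forest_indexing (V : finType) (E : {set {set V}}) (k : nat)
    (G : 'I_k -> subgraph V) : star_forest E G ->
  exists (c : 'I_k -> V) (T : 'I_k -> {set 'I_#|E|}),
    [/\ forall i, enum_val i \in forest_edges G <-> exists j, i \in T j,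
        forall j, (0 < #|T j|)%N,
        forall j i, i \in T j -> exists y,
          [/\ y != c j, enum_val i = [set c j; y]%SET &
              forall j' i', i' \in T j' -> y \in enum_val i' -> i' = i],
        forall j j' i, i \in T j' -> c j \in enum_val i -> j' = j &
        forall x, exists j i, i \in T j /\ x \in enum_val i].
Proof.
case=> sub card2 cover disj star.
pose c j := s2val (cid2 (star j)).
have hc j : c j \in sg_vert (G j) /\
    sg_edges (G j) = [set [set c j; y]%SET | y in sg_vert (G j) :\ c j]%SET.
  by split; [exact: s2valP (cid2 (star j)) | exact: s2valP' (cid2 (star j))].
pose T j : {set 'I_#|E|} := [set i | enum_val i \in sg_edges (G j)]%SET.
have vert_inj x j j' : x \in sg_vert (G j) -> x \in sg_vert (G j') -> j = j'.
  move=> xj xj'; apply/eqP/negPn/negP => /disj.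
  by move=> /pred0P/(_ x) /=; rewrite xj xj'.
have T_vert i j x : i \in T j -> x \in enum_val i -> x \in sg_vert (G j).
  rewrite inE => iT xi; have [[_ esub] _] := sub j.
  by move/fintype.subsetP: (esub _ iT); apply.
have T_edge i j : i \in T j ->
    exists y, [/\ y != c j, y \in sg_vert (G j) &
                  enum_val i = [set c j; y]%SET].
  rewrite inE (hc j).2 => /imsetP[y]; rewrite !inE => /andP[yc yV] ->.
  by exists y.
have leaf_edge j y : y \in sg_vert (G j) -> y != c j ->
    exists2 i, i \in T j & enum_val i = [set c j; y]%SET.
  move=> yV yc.
  have eG : [set c j; y]%SET \in sg_edges (G j).
    by rewrite (hc j).2; apply: imset_f; rewrite !inE yc.
  have eE : [set c j; y]%SET \in E.
    by have [[/fintype.subsetP + _] _] := sub j; apply.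
  by exists (enum_rank_in eE [set c j; y]%SET); rewrite ?inE enum_rankK_in.
have T_gt0 j : exists i, i \in T j.
  have : (0 < #|sg_vert (G j) :\ c j|)%N.
    by have := card2 j; rewrite (cardsD1 (c j)) (hc j).1 add1n ltnS.
  case/card_gt0P => y; rewrite !inE => /andP[yc yV].
  by have [i iT _] := leaf_edge j y yV yc; exists i.
exists c, T; split.
- move=> i; split=> [/bigcupP[j _ ij]|[j]].
    by exists j; rewrite inE.
  by rewrite inE => ij; apply/bigcupP; exists j.
- by move=> j; have [i iT] := T_gt0 j; apply/card_gt0P; exists i.
- move=> j i iT; have [y [yc yV eE]] := T_edge i j iT.
  exists y; split=> // j' i' iT' yi'.
  have jj' := vert_inj _ _ _ (T_vert _ _ _ iT' yi') yV; subst j'.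
  have [y' [yc' _ eE']] := T_edge i' j iT'.
  (* Both edges contain the common centre, and [y], not being the centre, is the leaf of each. *)
  apply: enum_val_inj; rewrite eE eE'; congr [set _; _]%SET.
  by move: yi'; rewrite eE' !inE (negPf yc) => /eqP.
- move=> j j' i iT ci; apply: (vert_inj (c j)); first exact: T_vert iT ci.
  exact: (hc j).1.
- move=> x; have : x \in [set: V]%SET by rewrite inE.
  rewrite -cover => /bigcupP[j _ xj]; have [xc|xc] := eqVneq x (c j).
    have [i iT] := T_gt0 j; exists j, i; split => //.
    by have [y [_ _ ->]] := T_edge i j iT; rewrite !inE xc eqxx.
  have [i iT eE] := leaf_edge j x xj xc.
  by exists j, i; split => //; rewrite eE !inE eqxx orbT.
Qed.

(** * Complex eigenvalues and the classification of equilibria *)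

Lemma eigenvalue_Re_Im (R : rcfType) (m : nat) (D : 'M[R]_m) (z : R[i]) :
  eigenvalue (map_mx (real_complex R) D) z ->
  exists a b : 'I_m -> R,
    [/\ forall j, \sum_i a i * D i j = complex.Re z * a j - complex.Im z * b j,
        forall j, \sum_i b i * D i j = complex.Re z * b j + complex.Im z * a j &
        exists i, ~ (a i = 0 /\ b i = 0)].
Proof.
case/eigenvalueP => y yD y0.
have Re_sum (f : 'I_m -> R[i]) :
    complex.Re (\sum_i f i) = \sum_i complex.Re (f i).
  by apply: (big_morph (@complex.Re R)) => // -[? ?] [? ?].
have Im_sum (f : 'I_m -> R[i]) :
    complex.Im (\sum_i f i) = \sum_i complex.Im (f i).
  by apply: (big_morph (@complex.Im R)) => // -[? ?] [? ?].
exists (fun i => complex.Re (y 0 i)), (fun i => complex.Im (y 0 i)); split.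
- move=> j; transitivity (complex.Re ((y *m map_mx (real_complex R) D) 0 j)).
    rewrite mxE Re_sum; apply: eq_bigr => i _; rewrite !mxE.
    by case: (y 0 i) => ? ? /=; rewrite mulr0 subr0.
  by rewrite yD mxE; case: z {yD} => ? ?; case: (y 0 j).
- move=> j; transitivity (complex.Im ((y *m map_mx (real_complex R) D) 0 j)).
    rewrite mxE Im_sum; apply: eq_bigr => i _; rewrite !mxE.
    by case: (y 0 i) => ? ? /=; rewrite mulr0 add0r.
  by rewrite yD mxE; case: z {yD} => ? ?; case: (y 0 j).
apply: contrapT => h; move/eqP: y0; apply; apply/rowP => i; rewrite mxE.
have [] : complex.Re (y 0 i) = 0 /\ complex.Im (y 0 i) = 0.
  by apply: contrapT => hi; apply: h; exists i.
by case: (y 0 i) => ? ? /= -> ->.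
Qed.

(** Instability may be witnessed by any Jacobian matrix, so uniqueness is what carries the bound on
    [D] over to it. *)
Lemma stable_or_critical_of_Re_le0 (R : realType) (V : finType)
    (E : {set {set V}}) (alpha : R) (v : 'rV[R]_#|E|) (D : 'M[R]_#|E|) :
  (forall i, 0 <= v 0 i) -> is_jacobian alpha v D ->
  (forall z, complex_eigenvalue D z -> complex.Re z <= 0) ->
  linearly_stable alpha v \/ critical alpha v.
Proof.
move=> v_ge0 JD Re_le0.
have [|not_stable] := pselect (linearly_stable alpha v); first by left.
right; split=> //; first by exists D.
case=> D' JD' [z]; rewrite -(jacobian_unique v_ge0 JD JD') => /Re_le0.
by rewrite leNgt => /negP.
Qed.

(** * Construction of the equilibrium and its stability *)

Theorem theorem1p25 (R : realType) (V : finType) (E : {set {set V}})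
    (hG : simple_graph E) (hconn : connected_graph E)
    (alpha : R) (halpha : 1 < alpha)
    (k : nat) (G : 'I_k -> subgraph V) (hforest : star_forest E G) :
  exists v : 'rV[R]_#|E|,
    [/\ equilibrium alpha v,
        forall i : 'I_#|E|, enum_val i \in forest_edges G -> 0 < v 0 i,
        forall i : 'I_#|E|, enum_val i \notin forest_edges G -> v 0 i = 0 &
        linearly_stable alpha v \/ critical alpha v].
Proof.
have [c [T [forestP T_gt0 leafP centerP coverP]]] :=
  star_forest_indexing hforest.
have center_in j i : i \in T j -> c j \in enum_val i.
  by case/leafP => y [_ -> _]; rewrite !inE eqxx.
have T_inj j j' i : i \in T j -> i \in T j' -> j' = j.
  by move=> iT iT'; exact: centerP iT' (center_in _ _ iT).
have [pw pwP] := choice (fun j => exists_star_weights alpha (T_gt0 j)).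
pose n : R := #|V|%:R.
have n_gt0 : 0 < n by rewrite ltr0n hconn.1.
pose v : 'rV[R]_#|E| :=
  \row_i (if [pick j | i \in T j] is Some j then (1 + pw j i) / n else 0).
have v_in j i : i \in T j -> v 0 i = (1 + pw j i) / n.
  move=> iT; rewrite mxE; case: pickP => [j' iT'|/(_ j)]; last by rewrite iT.
  by rewrite (T_inj _ _ _ iT iT').
have v_out i : ~ (exists j, i \in T j) -> v 0 i = 0.
  by move=> iN; rewrite mxE; case: pickP => // j iT; case: iN; exists j.
have p_gt0 j i : 0 < pw j i by have [h _ _ _] := pwP j; exact: h.
have v_gt0 j i : i \in T j -> 0 < v 0 i.
  by move=> /v_in ->; rewrite divr_gt0// addr_gt0.
have v_ge0 i : 0 <= v 0 i.
  have [[j /v_gt0/ltW//]|/v_out ->//] := pselect (exists j, i \in T j).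
have alpha0 : alpha != 0 by rewrite gt_eqF// (lt_trans ltr01).
have pow_out i : ~ (exists j, i \in T j) -> v 0 i `^ alpha = 0.
  by move=> /v_out ->; rewrite powR0.
(* A forest edge at the centre [c j] belongs to star [j], and every other edge has [0^alpha = 0]. *)
have sum_center j (a : 'I_#|E| -> R) :
    \sum_(i < #|E| | c j \in enum_val i) v 0 i `^ alpha * a i
    = \sum_(i in T j) v 0 i `^ alpha * a i.
  rewrite big_mkcond [RHS]big_mkcond; apply: eq_bigr => i _.
  have [iT|iNT] := boolP (i \in T j); first by rewrite (center_in _ _ iT).
  case: ifP => // ci; rewrite pow_out ?mul0r// => -[j' iT'].
  by move: iNT; rewrite -(centerP _ _ _ iT' ci) iT'.
have sum_leaf (i : 'I_#|E|) (y : V) (a : 'I_#|E| -> R) : y \in enum_val i ->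
    (forall j' i', i' \in T j' -> y \in enum_val i' -> i' = i) ->
    \sum_(i' < #|E| | y \in enum_val i') v 0 i' `^ alpha * a i'
    = v 0 i `^ alpha * a i.
  move=> yi leaf; rewrite (bigD1 i)//= big1 ?addr0// => i' /andP[yi' ii'].
  rewrite pow_out ?mul0r// => -[j' iT'].
  by rewrite (leaf _ _ iT' yi') eqxx in ii'.
have weightE x : vertex_weight alpha v x
    = \sum_(i < #|E| | x \in enum_val i) v 0 i `^ alpha * 1.
  by apply: eq_bigr => i _; rewrite mulr1.
have weight_leaf (i : 'I_#|E|) (y : V) : y \in enum_val i ->
    (forall j' i', i' \in T j' -> y \in enum_val i' -> i' = i) ->
    vertex_weight alpha v y = v 0 i `^ alpha.
  by move=> yi leaf; rewrite weightE (sum_leaf i)// mulr1.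
have weight_neq0 x : vertex_weight alpha v x != 0.
  have [j [i [iT xi]]] := coverP x.
  rewrite gt_eqF// /vertex_weight (bigD1 i)//=.
  rewrite ltr_wpDr ?powR_gt0 ?(v_gt0 _ _ iT)// sumr_ge0// => ? _.
  exact: powR_ge0.
(* [pw j i] is the probability that the centre selects edge [i]; the factors [n^(- alpha)]
   cancel. *)
have shareE j i : i \in T j ->
    v 0 i `^ alpha / vertex_weight alpha v (c j) = pw j i.
  move=> iT; have [_ _ fixed _] := pwP j.
  have u_pos i' : 0 <= 1 + pw j i' by rewrite addr_ge0// ltW.
  have Vi i' : i' \in T j ->
      v 0 i' `^ alpha = (1 + pw j i') `^ alpha * n^-1 `^ alpha.
    by move=> iT'; rewrite (v_in _ _ iT') powRM// invr_ge0 ltW.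
  apply: (canLR (mulfK (weight_neq0 _))).
  rewrite weightE sum_center Vi// fixed// -mulrA; congr (_ * _).
  rewrite mulr_suml; apply: eq_bigr => i' iT'.
  by rewrite mulr1 Vi.
have equil : warmF alpha v = 0.
  apply/rowP => i; rewrite [LHS]mxE [RHS]mxE.
  under eq_bigr do rewrite -/(vertex_weight alpha v _).
  have [[j iT]|iN] := pselect (exists j, i \in T j); last first.
    rewrite v_out// big1 ?mulr0 ?oppr0 ?addr0// => x _.
    by rewrite powR0// mul0r.
  (* The leaf contributes 1 and the centre [pw j i], which add up to [n v_i]. *)
  have [y [yc eE leaf]] := leafP _ _ iT.
  have yi : y \in enum_val i by rewrite eE !inE eqxx orbT.
  rewrite [in X in _ * X]eE big_setU1 ?big_set1/= ?inE 1?eq_sym//.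
  rewrite shareE// (weight_leaf i)// divff ?powR_eq0 ?(gt_eqF (v_gt0 _ _ iT))//.
  by rewrite (v_in _ _ iT) -/n; field; rewrite gt_eqF.
exists v; split.
- split=> //; split=> //.
  (* The total mass is 1 because [F] vanishes: at each of the [n] vertices the selection
     probabilities sum to 1. *)
  have : \sum_i warmF alpha v 0 i = 0.
    by rewrite equil big1// => i _; rewrite mxE.
  under eq_bigr do rewrite mxE.
  rewrite big_split/= sumrN -mulr_sumr.
  rewrite (_ : \sum_(i < #|E|) \sum_(x in _) _ = n).
    by rewrite -/n mulVf ?gt_eqF// => /eqP; rewrite addrC subr_eq0 => /eqP.
  transitivity (\sum_(x : V) (1 : R)); last by rewrite sumr_const.
  rewrite (exchange_big_dep xpredT)//=.
  apply: eq_bigr => x _.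
  by rewrite -mulr_suml divff// (weight_neq0 x).
- by move=> i /forestP[j /v_gt0].
- by move=> i iN; apply: v_out => iF; move: iN; rewrite (forestP i).2.
apply: (stable_or_critical_of_Re_le0 v_ge0
  (warm_jacobianP halpha v_ge0 weight_neq0)).
move=> z /eigenvalue_Re_Im[a [b [ha hb [i0 ab_neq0]]]].
(* Here [alpha > 1] enters through [0^(alpha - 1) = 0]. *)
have left_out i (y : 'I_#|E| -> R) : ~ (exists j, i \in T j) ->
    \sum_i' y i' * warm_jacobian alpha v i' i = - y i.
  move=> /v_out vi; rewrite warm_jacobian_left vi big1 ?mulr0 ?addr0// => x _.
  by rewrite powR0 ?subr_eq0 ?gt_eqF// mulr0 !mul0r.
have left_in j i (y : 'I_#|E| -> R) : i \in T j ->
    \sum_i' y i' * warm_jacobian alpha v i' i = - y i + alpha / (1 + pw j i)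
      * (pw j i * (y i - \sum_(i' in T j) pw j i' * y i')).
  move=> iT; rewrite warm_jacobian_left; congr (_ + _).
  (* At the leaf [l] the mean of [y] is [y i] itself, so only the centre contributes. Its
     coefficient [alpha v_i^(alpha - 1) / (n W)], with [W] the weight of the centre, equals
     [alpha p / (n v_i)], where [n v_i = 1 + p]. *)
  have [l [lc eE leaf]] := leafP _ _ iT.
  have li : l \in enum_val i by rewrite eE !inE eqxx orbT.
  have vi := v_gt0 _ _ iT.
  rewrite [in X in _ * X]eE big_setU1 ?big_set1/= ?inE 1?eq_sym//.
  rewrite (sum_leaf i l)// (weight_leaf i l)// [_ * y i]mulrC.
  rewrite mulfK ?subrr ?mulr0 ?addr0; last first.
    by rewrite powR_eq0 (gt_eqF vi).
  rewrite sum_center mulr_suml.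
  rewrite (eq_bigr (fun i' => pw j i' * y i')); last first.
    by move=> i' iT'; rewrite mulrAC shareE.
  have -> : 1 + pw j i = v 0 i * n by rewrite (v_in _ _ iT) divfK ?gt_eqF.
  rewrite -(shareE j i iT) powRB ?powRr1 ?(ltW vi)//; last first.
    by rewrite (gt_eqF vi) implybT.
  rewrite !mulrA; congr (_ * _).
  by rewrite -/n; field; rewrite weight_neq0 !gt_eqF.
(* A positive real part would force the eigenvector to vanish at [i0], whether or not this edge lies
   in the forest. *)
rewrite leNgt; apply/negP => Re_gt0; apply: ab_neq0.
have [[j iT]|iN] := pselect (exists j, i0 \in T j).
  have [_ p_sum _ p_form] := pwP j.
  apply: (star_spectrum (p_gt0 j) p_sum p_form _ _ Re_gt0 iT).
  - by move=> i iTj; rewrite -(left_in j i) ?ha.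
  - by move=> i iTj; rewrite -(left_in j i) ?hb.
have ea := ha i0; have eb := hb i0; rewrite !left_out// in ea eb.
exact: rotation_eq0 Re_gt0 ea eb.
Qed.
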